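(* Let $\mathbf{b}=(b_0,b_1,b_2,\ldots)$ be the increasing sequence of all $n\in\mathbb{N}$ such that $\binom{2n}{n}\equiv -1\pmod 3$. Let $\mathbf{t}=(t_0,t_1,\ldots)$ be the Thue–Morse sequence, i.e. $t_i$ is the remainder on division by $2$ of the number of ones in the binary expansion of $i$. Then $b_i\equiv 1-t_i\pmod 3$ for all $i\in\mathbb{N}$.
   Context: Equivalently, the Thue–Morse sequence is defined by $t_0=0$, $t_{2i}=t_i$, $t_{2i+1}=1-t_i$. *)

(* Defs.v *)
From mathcomp Require Import all_boot all_order all_algebra.

Set Implicit Arguments.
Unset Strict Implicit.
Unset Printing Implicit Defensive.

(* [odd (i %/ 2 ^ k)] is the k-th binary digit of i; since i < 2 ^ i, the
   digits of index k >= i are all 0, so the sum counts every one of i. *)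
Definition binary_ones (i : nat) : nat := \sum_(k < i) odd (i %/ 2 ^ k).

Definition thue_morse (i : nat) : nat := binary_ones i %% 2.

Definition central_binomial_m1_mod3 (n : nat) : Prop :=
  (('C(2 * n, n))%:Z = - 1 %[mod 3])%Z.

Definition increasing_sequence_of_all (P : nat -> Prop) (b : nat -> nat) : Prop :=
  {homo b : i j / i < j} /\ (forall n : nat, P n <-> exists i : nat, b i = n).

(* Main.v *)
Require Import Defs.
From mathcomp Require Import all_boot all_order all_algebra.
From mathcomp Require Import zify.

(** By Lucas' theorem, [3m], [3m+1] and [3m+2] have central binomials congruent
    to [C(2m,m)], [-C(2m,m)] and [0] modulo 3.  Hence [C(2n,n)] is [-1] modulo 3
    exactly when [n] is obtained by reading in base 3 the binary expansion of
    a number with an odd number of ones.  The i-th such number is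
    [2i + (1 - t_i)]; its last digit, [1 - t_i], is the residue of [b_i]. *)

(** Modulo 3, [(1 + x)^3] is [1 + x^3]: after three uses of Pascal's rule the two middle terms carry
    a factor 3. *)
Lemma bin_add3S m k : 'C(m + 3, k + 3) = 'C(m, k) + 'C(m, k + 3) %[mod 3].
Proof. rewrite !addnS !addn0 !binS; lia. Qed.

Lemma bin_add3_small m k : k < 3 -> 'C(m + 3, k) = 'C(m, k) %[mod 3].
Proof.
by case: k => [|[|[|//]]] _; rewrite !addnS addn0 ?binS ?bin0 ?bin1; lia.
Qed.

Lemma lucas3 a b r s : r < 3 -> s < 3 ->
  'C(3 * a + r, 3 * b + s) = 'C(a, b) * 'C(r, s) %[mod 3].
Proof.
move=> r3 s3; elim: a b => [|a IHa] [|b].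
- by rewrite !muln0 mul1n.
- by rewrite bin_small ?bin0n //; lia.
- rewrite (_ : 3 * a.+1 + r = 3 * a + r + 3) ?muln0 ?add0n; last by lia.
  by rewrite bin_add3_small //; have := IHa 0; rewrite muln0 !bin0.
- rewrite (_ : 3 * a.+1 + r = 3 * a + r + 3); last by lia.
  rewrite (_ : 3 * b.+1 + s = 3 * b + s + 3); last by lia.
  rewrite bin_add3S -modnDm IHa (_ : 3 * b + s + 3 = 3 * b.+1 + s); last by lia.
  by rewrite IHa modnDm binS mulnDl addnC.
Qed.

Lemma central_bin_mod3_0 m : 'C(2 * (3 * m), 3 * m) = 'C(2 * m, m) %[mod 3].
Proof. by have := @lucas3 (2 * m) m 0 0 isT isT; rewrite !addn0 muln1 mulnCA. Qed.

Lemma central_bin_mod3_1 m :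
  'C(2 * (3 * m + 1), 3 * m + 1) = 2 * 'C(2 * m, m) %[mod 3].
Proof.
rewrite (_ : 2 * (3 * m + 1) = 3 * (2 * m) + 2); last by lia.
by rewrite lucas3 // mulnC.
Qed.

(** Doubling a last digit 2 carries and leaves the digit 1, so Lucas gives the factor ['C(1, 2)],
    which is 0. *)
Lemma central_bin_mod3_2 m : 'C(2 * (3 * m + 2), 3 * m + 2) = 0 %[mod 3].
Proof.
rewrite (_ : 2 * (3 * m + 2) = 3 * (2 * m).+1 + 1); last by lia.
by rewrite lucas3 // muln0.
Qed.

(* The binary expansion of [n] read in base [w]. *)
Definition binary_in_base (w n : nat) : nat :=
  \sum_(k < n) odd (n %/ 2 ^ k) * w ^ k.

Lemma binary_in_base_widen w n m : n <= m ->
  \sum_(k < m) odd (n %/ 2 ^ k) * w ^ k = binary_in_base w n.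
Proof.
move=> /subnK <-; elim: (m - n) => [//|d IHd].
rewrite addSn big_ord_recr /= IHd divn_small ?addn0 //.
exact: leq_trans (ltn_expl n (ltnSn 1)) (leq_pexp2l _ (leq_addl d n)).
Qed.

Lemma binary_in_base_double w n (d : bool) :
  binary_in_base w (2 * n + d) = w * binary_in_base w n + d.
Proof.
have half_nd : (2 * n + d) %/ 2 = n by case: d; lia.
(* The widened range is nonempty even when [2 * n + d] is 0, so the lowest digit can be split
   off. *)
rewrite -(@binary_in_base_widen w _ (2 * n + d).+1) // big_ord_recl /=.
rewrite expn0 divn1 muln1 addnC; congr (_ + _); last first.
  by rewrite mul2n oddD odd_double oddb.
rewrite -(@binary_in_base_widen w n (2 * n + d)); last by lia.
rewrite big_distrr; apply: eq_bigr => k _ /=.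
by rewrite /bump add1n !expnS divnMA half_nd mulnCA.
Qed.

Lemma binary_ind (Q : nat -> Prop) :
  Q 0 -> (forall n (d : bool), Q n -> Q (2 * n + d)) -> forall n, Q n.
Proof.
move=> Q0 Qd n; elim/ltn_ind: n => -[//|n] IHn.
rewrite (_ : n.+1 = 2 * (n.+1 %/ 2) + odd n.+1); last by lia.
by apply/Qd/IHn; lia.
Qed.

Lemma binary_in_base0 w : binary_in_base w 0 = 0.
Proof. exact: big_ord0. Qed.

(** Reading in base 1 counts the ones, so the doubling rule for [binary_in_base] also yields the
    recurrence of the Thue-Morse sequence. *)
Lemma thue_morseE n : thue_morse n = binary_in_base 1 n %% 2.
Proof.
by congr (_ %% 2); apply: eq_bigr => k _; rewrite exp1n muln1.
Qed.

Lemma thue_morse_double n (d : bool) :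
  thue_morse (2 * n + d) = (thue_morse n + d) %% 2.
Proof. by rewrite !thue_morseE binary_in_base_double mul1n modnDml. Qed.

Lemma thue_morse_lt2 n : thue_morse n < 2.
Proof. exact: ltn_pmod. Qed.

(** If the last bit is 0, only that bit changes. If it is 1, the carry raises the higher part by at
    least 1, a gain of at least [w], which exceeds the lost 1. *)
Lemma binary_in_base_ltS w n : 1 < w ->
  binary_in_base w n < binary_in_base w n.+1.
Proof.
move=> w1; elim/binary_ind: n => [|n [] IHn].
- by rewrite (binary_in_base_double w 0 true) binary_in_base0 muln0.
- rewrite (_ : (2 * n + true).+1 = 2 * n.+1 + false); last by lia.
  rewrite !binary_in_base_double addn0.
  by apply: leq_trans (leq_mul (leqnn w) IHn); rewrite mulnS /=; lia.
- rewrite (_ : (2 * n + false).+1 = 2 * n + true); last by lia.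
  by rewrite !binary_in_base_double; lia.
Qed.

(** Each digit 1 contributes a factor 2, that is -1, and each digit 0 a factor 1. The product is
    [(-1)^t] with [t = thue_morse j], and this is [t + 1] modulo 3 for [t] in {0, 1}. *)
Lemma central_bin_binary_in_base3 j :
  'C(2 * binary_in_base 3 j, binary_in_base 3 j) = (thue_morse j).+1 %[mod 3].
Proof.
elim/binary_ind: j => [|j d IHj].
  by rewrite thue_morseE !binary_in_base0.
have := thue_morse_lt2 j; rewrite thue_morse_double binary_in_base_double.
case: d => tj; last by rewrite addn0 central_bin_mod3_0 IHj; lia.
by rewrite central_bin_mod3_1 -modnMmr IHj; lia.
Qed.

(** Descent on base 3 digits: a last digit 2 would make the coefficient vanish, so every digit is 0
    or 1 and can serve as a bit of [j]. *)
Lemma central_bin_mod3_neq0 n : 'C(2 * n, n) %% 3 != 0 ->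
  exists j, binary_in_base 3 j = n.
Proof.
elim/ltn_ind: n => -[_ _|n IHn]; first by exists 0; exact: binary_in_base0.
have n3 : n.+1 %/ 3 < n.+1 by lia.
move: (divn_eq n.+1 3) (ltn_pmod n.+1 (isT : 0 < 3)); rewrite mulnC.
case: (n.+1 %% 3) => [|[|[|//]]] En _; rewrite {1 2}En.
- rewrite addn0 central_bin_mod3_0 => /(IHn _ n3)[j Ej].
  by exists (2 * j + false); rewrite binary_in_base_double Ej -En.
- rewrite central_bin_mod3_1 => nz.
  have /(IHn _ n3)[j Ej] : 'C(2 * (n.+1 %/ 3), n.+1 %/ 3) %% 3 != 0 by lia.
  by exists (2 * j + true); rewrite binary_in_base_double Ej -En.
- by rewrite central_bin_mod3_2.
Qed.

Lemma central_binomial_m1_mod3E n :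
  central_binomial_m1_mod3 n <-> 'C(2 * n, n) %% 3 = 2.
Proof. by rewrite /central_binomial_m1_mod3; split; lia. Qed.

Lemma central_binomial_m1_mod3P n : central_binomial_m1_mod3 n <->
  exists i, 3 * binary_in_base 3 i + (1 - thue_morse i) = n.
Proof.
rewrite central_binomial_m1_mod3E; split=> [n2|[i <-]].
  have [|j Ej] := @central_bin_mod3_neq0 n; first by rewrite n2.
  have Dj : j = 2 * (j %/ 2) + odd j by lia.
  move: n2; rewrite -Ej central_bin_binary_in_base3 Dj => n2.
  (* The parity of the ones of [j] is odd, so its last bit is forced by the higher bits: it is
     [1 - thue_morse (j %/ 2)]. *)
  exists (j %/ 2); move: n2 (thue_morse_lt2 (j %/ 2)).
  rewrite binary_in_base_double thue_morse_double.
  by case: (odd j); lia.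
have := thue_morse_lt2 i.
(* Written as a boolean, the last term can be absorbed as a bit appended to [i]. *)
rewrite (_ : 1 - thue_morse i = (thue_morse i == 0)); last first.
  by have := thue_morse_lt2 i; case: (thue_morse i) => [|[]].
rewrite -binary_in_base_double central_bin_binary_in_base3 thue_morse_double.
by case: (thue_morse i) => [|[]].
Qed.

(** By induction [b i] is some [c j] with [i <= j], since the indices [j] must increase strictly
    with [i]. Applied both ways, this shows that an increasing enumeration is unique. *)
Lemma increasing_range_le (b c : nat -> nat) :
  {homo b : i j / i < j} -> {homo c : i j / i < j} ->
  (forall i, exists j, c j = b i) -> forall i, c i <= b i.
Proof.
move=> bS cS bc i; have cM := leq_mono cS.
suff [j leij <-] : exists2 j, i <= j & c j = b i by rewrite cM.
elim: i => [|i [j leij Ej]]; first by have [j <-] := bc 0; exists j.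
have [k Ek] := bc i.+1; exists k => //; apply: leq_ltn_trans leij _.
by rewrite -(leqW_mono cM) Ej Ek bS.
Qed.

Lemma increasing_sequence_of_all_unique (P : nat -> Prop) (b c : nat -> nat) :
  increasing_sequence_of_all P b -> increasing_sequence_of_all P c -> b =1 c.
Proof.
move=> [bS bP] [cS cP] i; apply/eqP; rewrite eqn_leq.
by rewrite !increasing_range_le // => j; [apply/cP/bP | apply/bP/cP]; exists j.
Qed.

Lemma central_binomial_m1_mod3_sequence :
  increasing_sequence_of_all central_binomial_m1_mod3
    (fun i => 3 * binary_in_base 3 i + (1 - thue_morse i)).
Proof.
split; last exact: central_binomial_m1_mod3P.
apply: homo_ltn => [|i]; first exact: ltn_trans.
(* The first term grows by at least 3, while the last digit drops by at most 1. *)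
by have := @binary_in_base_ltS 3 i isT; lia.
Qed.

Theorem theorem4p6 (b : nat -> nat)
    (hb : increasing_sequence_of_all central_binomial_m1_mod3 b) (i : nat) :
  ((b i)%:Z = 1 - (thue_morse i)%:Z %[mod 3])%Z.
Proof.
rewrite (increasing_sequence_of_all_unique _ _ _ hb central_binomial_m1_mod3_sequence).
by have := thue_morse_lt2 i; lia.
Qed.
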